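(* Let $L$ be a modular quantale. An element $x\in L$ is a $\mu$-element if and only if $x$ is either essential or irreducible.
   Context: A quantale here means an integral commutative quantale: a complete lattice $(L,\leqslant,0,1)$ with an associative, commutative multiplication distributing over arbitrary joins and having the top element $1$ as multiplicative identity. It is modular if its underlying lattice is modular. An element $x\in L$ is a $\mu$-element if for every natural number $n\geqslant 2$ and all $y_1,\ldots,y_n\in L$ with $\bigwedge_{k=1}^n y_k\neq 0$, the condition $x\wedge y_k\neq 0$ for every $k$ implies $x\wedge\bigl(\bigwedge_{k=1}^n y_k\bigr)\neq 0$. An element $x\in L$ is essential if $x\wedge y\neq 0$ for all $y\in L$ with $y\neq 0$. An element $x\in L$ is irreducible if for all $y,z\in L$ with $y\leqslant x$, $z\leqslant x$ and $y\wedge z=0$, one has $y=0$ or $z=0$ (in particular $0$ is irreducible). *)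

(* Defs.v *)
From HB Require Import structures.
From mathcomp Require Import all_boot all_order.
From mathcomp Require Import classical_sets.

Set Implicit Arguments.
Unset Strict Implicit.
Unset Printing Implicit Defensive.

Import Order.TTheory.
Local Open Scope classical_set_scope.
Local Open Scope order_scope.

(* The existence of all suprema yields that of all infima, so this is the usual
   notion of complete lattice; \bot and \top are inherited from tbLatticeType. *)
HB.mixin Record TBLattice_isComplete d (T : Type) of Order.TBLattice d T := {
  bigjoin : set T -> T;
  bigjoinP : forall A : set T, supremums A (bigjoin A)
}.

#[short(type="completeLatticeType")]
HB.structure Definition CompleteLattice d :=
  { T of TBLattice_isComplete d T & Order.TBLattice d T }.

(* Integral commutative quantales: the multiplicative unit is \top.
   By commutativity, one-sided unit and distributivity laws suffice. *)
HB.mixin Record CompleteLattice_isQuantale d (T : Type)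
    of CompleteLattice d T := {
  qmul : T -> T -> T;
  qmulA : associative qmul;
  qmulC : commutative qmul;
  qmul1x : left_id \top qmul;
  qmul_bigjoinr : forall (x : T) (A : set T),
    qmul x (bigjoin A) = bigjoin [set qmul x y | y in A]
}.

#[short(type="quantaleType")]
HB.structure Definition Quantale d :=
  { T of CompleteLattice_isQuantale d T & CompleteLattice d T }.

Definition modular_lattice d (L : latticeType d) : Prop :=
  forall x y z : L, x <= z -> x `|` (y `&` z) = (x `|` y) `&` z.

Definition mu_element d (L : quantaleType d) (x : L) : Prop :=
  forall n : nat, (2 <= n)%N -> forall y : 'I_n -> L,
    \meet_(k < n) y k != \bot ->
    (forall k : 'I_n, x `&` y k != \bot) ->
    x `&` \meet_(k < n) y k != \bot.

Definition essential d (L : quantaleType d) (x : L) : Prop :=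
  forall y : L, y != \bot -> x `&` y != \bot.

Definition irreducible d (L : quantaleType d) (x : L) : Prop :=
  forall y z : L, y <= x -> z <= x -> y `&` z = \bot -> y = \bot \/ z = \bot.

(* Main.v *)
Require Import Defs.
From mathcomp Require Import all_boot all_order.
From mathcomp Require Import boolp.

Import Order.TTheory.

(** For the forward direction, suppose [x] is neither essential nor irreducible:
    [x] misses some nonzero [z], and [a, b <= x] are nonzero and disjoint. By
    modularity [x] meets [a \/ z] in [a] and [b \/ z] in [b], so these two
    elements both meet [x] and have a nonzero meet (it contains [z]), whose
    meet with [x] is [a /\ b = 0]. *)

Local Open Scope order_scope.

Lemma modular_meet_join_disjoint {d : Order.disp_t} {L : tbLatticeType d}
    (L_modular : modular_lattice L) {x a z : L} :
  a <= x -> x `&` z = \bot -> x `&` (a `|` z) = a.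
Proof. by move=> ax xz0; rewrite meetC -L_modular // meetC xz0 joinx0. Qed.

Lemma essential_mu_element {d : Order.disp_t} {L : quantaleType d} (x : L) :
  essential x -> mu_element x.
Proof. by move=> x_ess n _ y y_neq0 _; apply: x_ess. Qed.

(** Induction on the meet: the meets of [x] with [y k] and with the partial meet [m] are nonzero and
    lie below [x], so by irreducibility they cannot be disjoint. *)
Lemma irreducible_mu_element {d : Order.disp_t} {L : quantaleType d} (x : L) :
  irreducible x -> mu_element x.
Proof.
move=> x_irr n n_ge2 y _ xy_neq0.
(* The induction starts from the empty meet [\top], where this is the claim; index 0 gives it. *)
have x_neq0 : x != \bot.
  apply/eqP => x0; have := xy_neq0 (Ordinal (ltnW n_ge2)).
  by rewrite x0 meet0x eqxx.
elim/big_rec: _ => [|k m _ xm_neq0]; first by rewrite meetx1.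
apply/eqP => xkm0.
case: (x_irr (x `&` y k) (x `&` m)); rewrite ?leIl //.
- by rewrite meetACA meetxx.
- by move/eqP; rewrite (negPf (xy_neq0 k)).
- by move/eqP; rewrite (negPf xm_neq0).
Qed.

Lemma mu_element_pair {d : Order.disp_t} {L : quantaleType d} (x u v : L) :
  mu_element x -> u `&` v != \bot -> x `&` u != \bot -> x `&` v != \bot ->
  x `&` (u `&` v) != \bot.
Proof.
move=> x_mu uv xu xv.
have := x_mu 2 isT (fun k => if k == ord0 then u else v).
rewrite !big_ord_recl big_ord0 /= meetx1; apply=> // k.
by case: ifP.
Qed.

Theorem theorem5p9 (d : Order.disp_t) (L : quantaleType d)
    (L_modular : modular_lattice L) (x : L) :
  mu_element x <-> essential x \/ irreducible x.
Proof.
split=> [x_mu|[]]; last 2 first.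
- exact: essential_mu_element.
- exact: irreducible_mu_element.
have [|x_ness] := pselect (essential x); [by left | right].
move=> a b ax bx ab0.
have [|a_neq0] := eqVneq a \bot; first by left.
have [|b_neq0] := eqVneq b \bot; first by right.
case: x_ness => z z_neq0; apply/eqP => xz0.
have xaz := modular_meet_join_disjoint L_modular ax xz0.
have xbz := modular_meet_join_disjoint L_modular bx xz0.
have : x `&` ((a `|` z) `&` (b `|` z)) != \bot.
  apply: mu_element_pair; rewrite ?xaz ?xbz //.
  apply: contraNneq z_neq0 => azbz0.
  by rewrite -lex0 -azbz0 lexI !leUr.
(* Doubling [x] gives each join its own copy, so the meet collapses to that of [a] and [b]. *)
by rewrite -[X in X `&` _]meetxx meetACA xaz xbz ab0 eqxx.
Qed.
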